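(* Let $T$ be a pruned rooted (order-theoretic) tree and $\kappa$ be an infinite cardinal. The following are equivalent: (a) $L(\mathcal R(T))=\kappa$. (b) $e(\mathcal R(T))=\kappa$. (c) $\kappa$ is the least infinite cardinal such that every $t\in T$ has at most $\kappa$ many immediate successors in $T$.
   Context: An order-theoretic tree is a partially ordered set $(T,<)$ such that for every $t\in T$ the set $\{s\in T: s<t\}$ is well-ordered by $<$. It is rooted if it has a least element (the root). A ray of $T$ is a nonempty downward closed chain $R\subseteq T$ with no maximal element (it need not be a maximal chain). $T$ is pruned if every node of $T$ belongs to some ray of $T$. The ray space $\mathcal R(T)$ is the set of all rays of $T$, topologized as a subspace of $\mathcal P(T)\cong 2^T$ with the product topology; i.e. a subbasis is given by the sets $[t]=\{R\in\mathcal R(T): t\in R\}$ and $\mathcal R(T)\setminus[t]$, for $t\in T$. For a topological space $X$: the Lindelöf degree $L(X)$ is the least infinite cardinal $\lambda$ such that every open cover of $X$ has a subcover of cardinality at most $\lambda$; the extent is $e(X)=\sup\{|C|: C \text{ is a closed discrete subset of } X\}+\aleph_0$. *)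

(* Defs.v *)
From mathcomp Require Import all_boot all_order.
From mathcomp Require Import all_classical.
From mathcomp Require wochoice.
From mathcomp Require Import topology.
Set Implicit Arguments.
Unset Strict Implicit.
Unset Printing Implicit Defensive.
Local Open Scope classical_set_scope.
Local Open Scope card_scope.
Local Open Scope order_scope.

(* A cardinal is represented by a type of that cardinality; equality of
   cardinals is equipotence [#=] and their order is [#<=]. *)

Definition least_infinite_cardinal (P : Type -> Prop) (K : Type) : Prop :=
  [/\ infinite_set [set: K], P K &
      forall L : Type, infinite_set [set: L] -> P L -> [set: K] #<= [set: L]].

(* |S| = sup {|C| : C in F} *)
Definition cardinal_sup (U : Type) (F : set (set U)) (S : Type) : Prop :=
  (forall C, F C -> C #<= [set: S]) /\
  (forall S' : Type, (forall C, F C -> C #<= [set: S']) ->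
    [set: S] #<= [set: S']).

Section Topology.
Variable X : topologicalType.

Definition open_cover (C : set (set X)) : Prop :=
  C `<=` open /\ \bigcup_(U in C) U = [set: X].

(* L(X) = |K| *)
Definition lindelof_degree (K : Type) : Prop :=
  least_infinite_cardinal (fun L : Type =>
    forall C : set (set X), open_cover C ->
    exists C' : set (set X), [/\ C' `<=` C, open_cover C' & C' #<= [set: L]]) K.

(* [set_type C] carries the subspace topology. *)
Definition closed_discrete (C : set X) : Prop :=
  closed C /\ forall A : set (set_type C), open A.

(* e(X) = |K|; the sum type [S + nat] has cardinality |S| + aleph_0. *)
Definition extent (K : Type) : Prop :=
  exists2 S : Type, cardinal_sup closed_discrete S &
    [set: K] #= [set: (S + nat)%type].

End Topology.

Section Trees.
Variables (d : Order.disp_t) (T : porderType d).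

Definition tree : Prop :=
  forall t : T, wochoice.wo_chain <=%O [pred s : T | s < t].

Definition rooted : Prop := exists r : T, forall t : T, r <= t.

Definition ray (R : set T) : Prop :=
  [/\ R !=set0,
      forall s t, R t -> s <= t -> R s,
      total_on R <=%O &
      forall t, R t -> exists2 s, R s & t < s].

Definition pruned : Prop := forall t : T, exists2 R : set T, ray R & R t.

Definition immediate_successors (t : T) : set T :=
  [set s | t < s /\ ~ exists u, t < u < s].

(* The power set of T, identified with 2^T, carries the product topology
   [{ptws T -> bool}] of the discrete space [bool]. *)
Definition ray_space : topologicalType :=
  set_type [set R : {ptws T -> bool} | ray [set t | R t]].

End Trees.

(* Main.v *)
Require Import Defs.
From mathcomp Require Import all_boot all_order.
From mathcomp Require Import all_classical topology.
Set Implicit Arguments.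
Unset Strict Implicit.
Unset Printing Implicit Defensive.
Local Open Scope classical_set_scope.
Local Open Scope card_scope.

(** The three conditions each say that [K] is the least infinite cardinal [L]
    with a certain property: every open cover of the ray space has a subcover
    of size at most [L]; every closed discrete set has size at most [L]; every
    node has at most [L] immediate successors.  For the extent this reading
    absorbs the summand aleph_0 ([least_infinite_cardinal_sup]).  It remains to
    see that the three properties are equivalent for each infinite [L].

    A closed discrete set [D] yields an open cover, its complement together
    with open sets isolating the points of [D], whose subcovers have at least
    as many members as [D] has points ([closed_discrete_card_le]).  The
    successors of a node [t], extended to rays one by one, yield a closed
    discrete set of the same size, since every ray through [t] passes through
    exactly one of them ([closed_discrete_successors]).

    The converse [lindelof_le_ray_space] is the heart of the matter.  Suppose
    that every node has at most [L] successors and fix an open cover.  Call a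
    node [t] bad if the set of rays through [t], [cone t], is not covered by at
    most [L] members.  If the cover has no small subcover then the root is bad.
    Every bad node has a bad successor, since [L * L = L].  When a ray [R]
    consists of bad nodes, a basic neighbourhood of [R] inside a member of the
    cover is of the form [cone s] minus the cones of finitely many nodes lying
    above the whole of [R]; as [s] is bad, one of these nodes is bad
    ([ray_covered_cone]).  Hence a maximal chain of bad nodes can neither have
    a last element nor be a ray, although it is closed downwards. *)

(** * Cardinal arithmetic *)

(** Injections are awkward to build between sets that may be empty or live in
    types without a default element.  A total injective relation, possibly
    multivalued, is enough thanks to choice. *)
Lemma card_le_relP (T U : Type) (A : set T) (B : set U) :
  A #<= B <-> exists R : T -> U -> Prop,
    (forall x, A x -> exists2 y, B y & R x y) /\
    (forall x x' y, A x -> A x' -> R x y -> R x' y -> x = x').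
Proof.
split=> [/card_leP[f]|[R [Rtot Rinj]]].
  exists (fun x y => exists2 a : A, val a = x & val (f a) = y); split.
    move=> x Ax; exists (val (f (SigSub (mem_set Ax)))); first exact: set_valP.
    by exists (SigSub (mem_set Ax)).
  move=> _ _ _ _ _ [a <- <-] [b <-] /val_inj fab.
  by congr val; apply: esym; apply: (@inj _ _ _ f) fab; rewrite inE.
have /choice[f fP] : forall a : A, exists b : B, R (val a) (val b).
  move=> a; have [y By Ry] := Rtot _ (set_valP a).
  by exists (SigSub (mem_set By)).
apply/card_leP/injfunPex; exists f => // a b _ _ ab; apply: val_inj.
by apply: Rinj (fP a) _; rewrite ?ab//; exact: set_valP.
Qed.

Lemma card_le_inj (T U : Type) (f : T -> U) :
  injective f -> [set: T] #<= [set: U].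
Proof.
move=> finj; apply/card_le_relP; exists (fun x y => y = f x).
by split=> [x _|x x' _ _ _ -> /finj //]; exists (f x).
Qed.

(** A maximal partial bijection between [A] and [B] exhausts one of the two
    sides. *)
Lemma card_le_total (T U : Type) (A : set T) (B : set U) : A #<= B \/ B #<= A.
Proof.
pose P (G : set (T * U)) := [/\ G `<=` A `*` B,
  forall x x' y, G (x, y) -> G (x', y) -> x = x' &
  forall x y y', G (x, y) -> G (x, y') -> y = y'].
have [|G [[GAB Ginj Gfun] Gmax]] := @Zorn_bigcup _ P.
  move=> F FP Ftot; split.
  - by apply: bigcup_sub => G /FP[GAB _ _].
  - move=> x x' y [G FG Gx] [H FH Hx].
    have [/(_ _ Gx) Hx'|/(_ _ Hx) Gx'] := Ftot _ _ FG FH.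
      by have [_ inj _] := FP _ FH; exact: inj Hx' Hx.
    by have [_ inj _] := FP _ FG; exact: inj Gx Gx'.
  - move=> x y y' [G FG Gx] [H FH Hx].
    have [/(_ _ Gx) Hx'|/(_ _ Hx) Gx'] := Ftot _ _ FG FH.
      by have [_ _ inj] := FP _ FH; exact: inj Hx' Hx.
    by have [_ _ inj] := FP _ FG; exact: inj Gx Gx'.
have [Adom|/existsNP[a /not_implyP[Aa Ga]]] :=
  pselect (forall x, A x -> exists y, G (x, y)).
  left; apply/card_le_relP; exists (fun x y => G (x, y)); split=> [x Ax|x x' y _ _].
    by have [y Gxy] := Adom x Ax; exists y => //; have [] := GAB _ Gxy.
  exact: Ginj.
have [Bdom|/existsNP[b /not_implyP[Bb Gb]]] :=
  pselect (forall y, B y -> exists x, G (x, y)).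
  right; apply/card_le_relP; exists (fun y x => G (x, y)); split=> [y By|y y' x _ _].
    by have [x Gxy] := Bdom y By; exists x => //; have [] := GAB _ Gxy.
  exact: Gfun.
exfalso; apply: (Gmax ((a, b) |` G)).
  split; first exact: subsetUr.
  by move=> /(_ (a, b)) /(_ (or_introl erefl)) Gab; apply: Ga; exists b.
split.
- by move=> p [->|/GAB].
- move=> x x' y [[-> ->]|Gx] [[]|Gx'] //; last exact: Ginj Gx Gx'.
  + by exfalso; apply: Gb; exists x'.
  + by move=> _ yb; exfalso; apply: Gb; exists x; rewrite -yb.
- move=> x y y' [[-> ->]|Gx] [[]|Gx'] //; last exact: Gfun Gx Gx'.
  + by exfalso; apply: Ga; exists y'.
  + by move=> xa; exfalso; apply: Ga; exists y; rewrite -xa.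
Qed.

Lemma card_le_setX (T T' U U' : Type) (A : set T) (A' : set T')
    (B : set U) (B' : set U') :
  A #<= B -> A' #<= B' -> A `*` A' #<= B `*` B'.
Proof.
move=> /card_le_relP[R [Rtot Rinj]] /card_le_relP[S [Stot Sinj]].
apply/card_le_relP; exists (fun p q => R p.1 q.1 /\ S p.2 q.2); split.
  move=> [x x'] [/= /Rtot[y By Ry] /Stot[y' By' Sy']].
  by exists (y, y').
move=> [x x'] [z z'] [y y'] [/= Ax Ax'] [/= Az Az'] [Rx Sx] [Rz Sz].
by congr pair; [exact: Rinj Rx Rz|exact: Sinj Sx Sz].
Qed.

(** The union embeds into [C * C], with two distinct points of [C] as tags. *)
Lemma card_le_setU (T U : Type) (A B : set T) (C : set U) :
  infinite_set C -> C `*` C #<= C -> A #<= C -> B #<= C -> A `|` B #<= C.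
Proof.
move=> Cinf CC AC BC; apply: card_le_trans CC.
have /infiniteP/card_le_relP[N [Ntot Ninj]] := Cinf.
have [c Cc Nc] := Ntot 0%N Logic.I; have [d Cd Nd] := Ntot 1%N Logic.I.
have cd : c <> d by move=> e; rewrite -e in Nd; have := Ninj _ _ _ Logic.I Logic.I Nc Nd.
move: AC BC => /card_le_relP[R [Rtot Rinj]] /card_le_relP[S [Stot Sinj]].
apply/card_le_relP; exists (fun x p =>
  (A x /\ p.1 = c /\ R x p.2) \/ (B x /\ p.1 = d /\ S x p.2)); split.
  move=> x [Ax|Bx].
    by have [y Cy Ry] := Rtot _ Ax; exists (c, y) => //; left.
  by have [y Cy Sy] := Stot _ Bx; exists (d, y) => //; right.
move=> x x' [e y] _ _ [[Ax [/= -> Rx]]|[Bx [/= -> Sx]]] [[Ax' [+ Rx']]|[Bx' [+ Sx']]].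
- by move=> _; exact: Rinj Rx Rx'.
- by [].
- by move/esym.
- by move=> _; exact: Sinj Sx Sx'.
Qed.

(** Zorn's lemma is applied to sets [G] of triples that encode, on some subset
    [D G] of [L], a total injective relation from [D G * D G] to [D G].  The
    diagonal suffices to recover [D G], so that inclusion of the [G]s is the
    right order.  A maximal [G] has a domain [A] of full cardinality: otherwise
    the complement of [A] contains a set [B] large enough to receive all the
    new pairs of [A `|` B]. *)
Lemma infinite_setX_le (L : Type) :
  infinite_set [set: L] -> [set: L * L] #<= [set: L].
Proof.
move=> Linf.
pose D (G : set (L * L * L)) := [set x | exists z, G (x, x, z)].
pose P (G : set (L * L * L)) := [/\
  forall x y z, G (x, y, z) -> [/\ D G x, D G y & D G z],
  forall x y, D G x -> D G y -> exists z, G (x, y, z) &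
  forall p q z, G (p, z) -> G (q, z) -> p = q].
have [|G [[Gsub Gtot Ginj] Gmax]] := @Zorn_bigcup _ P.
  move=> F FP Ftot.
  have DF G : F G -> D G `<=` D (\bigcup_(H in F) H).
    by move=> FG x [z Gz]; exists z; exists G.
  split.
  - move=> x y z [G FG Gxyz]; have [+ _ _] := FP _ FG.
    by move=> /(_ _ _ _ Gxyz)[Dx Dy Dz]; split; exact: (DF G).
  - move=> x y [z [G FG Gx]] [w [H FH Hy]].
    have [K [FK Kx Ky]] : exists K, [/\ F K, D K x & D K y].
      have [GH|HG] := Ftot _ _ FG FH.
        by exists H; split=> //; [exists z; exact: GH|exists w].
      by exists G; split=> //; [exists z|exists w; exact: HG].
    have [_ /(_ _ _ Kx Ky)[v Kv] _] := FP _ FK.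
    by exists v; exists K.
  - move=> p q z [G FG Gp] [H FH Hq].
    have [/(_ _ Gp) Hp|/(_ _ Hq) Gq] := Ftot _ _ FG FH.
      by have [_ _ inj] := FP _ FH; exact: inj Hp Hq.
    by have [_ _ inj] := FP _ FG; exact: inj Gp Gq.
set A := D G in Gsub Gtot.
have AA : A `*` A #<= A.
  apply/card_le_relP; exists (fun p z => G (p, z)); split=> [[x y] [Ax Ay]|p q z _ _].
    by have [z Gz] := Gtot _ _ Ax Ay; exists z => //; have [] := Gsub _ _ _ Gz.
  exact: Ginj.
(* [B] is the reservoir of values for the pairs that are not in [A * A]. *)
have noext (B : set L) : B !=set0 -> B `<=` ~` A ->
    (A `|` B) `*` (A `|` B) #<= B -> False.
  move=> [b Bb] BA /card_le_relP[R [Rtot Rinj]].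
  pose H := [set q : L * L * L | [/\ (A `|` B) q.1.1, (A `|` B) q.1.2, ~ (A `*` A) q.1,
                      B q.2 & R q.1 q.2]].
  have Htot x y : (A `|` B) x -> (A `|` B) y -> exists z, (G `|` H) (x, y, z).
    move=> ABx ABy; have [[Ax Ay]|nA] := pselect ((A `*` A) (x, y)).
      by have [z Gz] := Gtot _ _ Ax Ay; exists z; left.
    by have [z Bz Rz] := Rtot (x, y) (conj ABx ABy); exists z; right.
  have DE : D (G `|` H) = A `|` B.
    apply/seteqP; split=> [x [z [Gx|[]//]]|x ABx]; first by left; exists z.
    exact: Htot.
  apply: (Gmax (G `|` H)).
    split; first exact: subsetUl.
    have [z [Gz|Hz]] := Htot b b (or_intror Bb) (or_intror Bb).
      by exfalso; apply: (BA _ Bb); exists z.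
    by move=> /(_ _ (or_intror Hz)) Gz; apply: (BA _ Bb); exists z.
  split; rewrite ?DE //.
  - move=> x y z [/Gsub[]|[]]; first by split; left.
    by move=> /= ? ? _ Bz _; split=> //; right.
  - move=> p q z [Gp|[/= ? ? _ Bz Rp]] [Gq|[/= ? ? _ Bz' Rq]].
    + exact: Ginj Gp Gq.
    + by exfalso; apply: (BA _ Bz'); case: p Gp => ? ? /Gsub[].
    + by exfalso; apply: (BA _ Bz); case: q Gq => ? ? /Gsub[].
    + exact: Rinj Rp Rq.
(* A finite [A] has to be excluded separately: [AA] is then no information,
   for instance at [A = set0]. *)
have [Afin|Ainf] := pselect (finite_set A).
  have /infiniteP/card_subP[B BN BA] : infinite_set (~` A).
    by rewrite -setTD; exact: infinite_setD.
  have Binf : infinite_set B by apply/infiniteP; move: BN; rewrite card_eq_le => /andP[].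
  exfalso; apply: (noext B) => //; first exact: infinite_setN0.
  have ABc : countable (A `|` B).
    rewrite -bigcup2inE; apply: bigcup_countable => [|[|[|//]] _].
    - exact: countableP.
    - exact: finite_set_countable.
    - by move: BN; rewrite card_eq_le => /andP[].
  by apply: card_le_trans (countableX ABc ABc) _; exact/infiniteP.
(* An infinite [A] with [A * A] of the size of [A] absorbs its complement if
   this is not larger; otherwise the complement contains a copy [B] of [A], and
   [A `|` B] has no more pairs than [B] has elements. *)
have AUL X Y : X #<= A -> Y #<= A -> (X `|` Y) #<= A.
  exact: card_le_setU.
have [LA|AL] := card_le_total (~` A) A.
  have : A `|` ~` A #<= A by exact: AUL.
  rewrite setUv => TA; apply: card_le_trans (card_leT A).
  by rewrite -setXTT; apply: card_le_trans AA; exact: card_le_setX.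
have /card_subP[B BA BC] := AL.
have [AB BA'] : A #<= B /\ B #<= A.
  by move: BA; rewrite card_eq_le => /andP[].
exfalso; apply: (noext B) => //.
  by apply/infinite_setN0/infiniteP/(card_le_trans _ AB)/infiniteP.
by apply: card_le_trans AB; apply: card_le_trans AA; apply: card_le_setX; exact: AUL.
Qed.

Lemma card_le_bigcup (I T L : Type) (D : set I) (F : I -> set T) :
  infinite_set [set: L] -> D #<= [set: L] ->
  (forall i, D i -> F i #<= [set: L]) -> \bigcup_(i in D) F i #<= [set: L].
Proof.
move=> Linf /card_le_relP[R [Rtot Rinj]] FL.
apply: card_le_trans (infinite_setX_le Linf).
have /choice[S SP] : forall i, exists S : T -> L -> Prop, D i ->
    (forall x, F i x -> exists2 y, [set: L] y & S x y) /\
    (forall x x' y, F i x -> F i x' -> S x y -> S x' y -> x = x').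
  move=> i; have [Di|nDi] := pselect (D i); last by exists (fun _ _ => True).
  by have /card_le_relP[S] := FL _ Di; exists S.
apply/card_le_relP; exists (fun x p => exists i, [/\ D i, F i x, R i p.1 & S i x p.2]).
split=> [x [i Di Fx]|x x' [l m] _ _ [i [Di Fx Ri Sx]] [j [Dj Fx' Rj Sx']]].
  have [l _ Rl] := Rtot _ Di; have [Stot _] := SP _ Di.
  by have [m _ Sm] := Stot _ Fx; exists (l, m) => //; exists i.
have ij := Rinj _ _ _ Di Dj Ri Rj; rewrite -ij in Fx' Sx'.
by have [_ Sinj] := SP _ Di; exact: Sinj Sx Sx'.
Qed.

Lemma card_le_sum_nat (S L : Type) :
  infinite_set [set: L] -> [set: S] #<= [set: L] -> [set: S + nat] #<= [set: L].
Proof.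
move=> Linf SL.
have -> : [set: (S + nat)%type] = range inl `|` range inr.
  by apply/seteqP; split=> // -[x|x] _; [left|right]; exists x.
apply: card_le_setU => //.
- by rewrite setXTT; exact: infinite_setX_le.
- by apply: card_le_trans SL; exact: card_image_le.
- by apply: card_le_trans (_ : [set: nat] #<= _); [exact: card_image_le|exact/infiniteP].
Qed.

(** The supremum of the cardinals [|C|] may be finite, in which case [S] is
    finite while [S + nat] is countable; only then does [S] differ from [K]. *)
Lemma least_infinite_cardinal_sup (U : Type) (F : set (set U)) (K : Type) :
  (exists2 S : Type, cardinal_sup F S & [set: K] #= [set: S + nat]) <->
  least_infinite_cardinal (fun L => forall C, F C -> C #<= [set: L]) K.
Proof.
split=> [[S [FS Sleast] KS]|[Kinf FK Kleast]].
  have SK : [set: S + nat] #<= [set: K].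
    by move: KS; rewrite card_eq_le => /andP[].
  have inlK : [set: S] #<= [set: S + nat] by apply: (@card_le_inj _ _ inl) => x y [].
  have inrK : [set: nat] #<= [set: S + nat] by apply: (@card_le_inj _ _ inr) => x y [].
  split=> [|C FC|L Linf FL].
  - by apply/infiniteP; exact: card_le_trans SK.
  - by apply: card_le_trans SK; apply: card_le_trans inlK; exact: FS.
  - move: KS; rewrite card_eq_le => /andP[KS _]; apply: card_le_trans KS _.
    by apply: card_le_sum_nat => //; exact: Sleast.
pose bound n := `[< forall C, F C -> C #<= `I_n >].
have [[n0 n0P]|nobound] := pselect (exists n, bound n).
  (* The least bound is the supremum: every [S'] as in [cardinal_sup] is then
     infinite or a bound. *)
  have [n /asboolP nP nmin] := find_ex_minn (ex_intro _ n0 n0P).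
  exists 'I_n.
    split=> [C FC|S' FS'].
      by rewrite -(card_le_eqr card_II); exact: nP.
    have [/finite_setP[m S'm]|/infiniteP NS'] := pselect (finite_set [set: S']).
      rewrite (card_le_eqr S'm) -(card_le_eql card_II) card_le_II; apply: nmin.
      by apply/asboolP => C /FS'; rewrite (card_le_eqr S'm).
    by apply: card_le_trans NS'; exact: countableP.
  rewrite card_eq_le card_le_sum_nat //; last first.
    by apply: card_le_trans (countableP _) _; exact/infiniteP.
  rewrite andbT; apply: card_le_trans (_ : [set: K] #<= [set: nat]) _.
    apply: Kleast; first exact: infinite_nat.
    by move=> C /nP /card_le_trans; apply; exact: countableP.
  by apply: (@card_le_inj _ _ inr) => x y [].
exists K; first (split=> // S' FS').
  apply: Kleast => // /finite_setP[m S'm]; apply: nobound; exists m.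
  by apply/asboolP => C /FS'; rewrite (card_le_eqr S'm).
rewrite card_eq_le card_le_sum_nat // andbT.
by apply: (@card_le_inj _ _ inl) => x y [].
Qed.

Lemma eq_least_infinite_cardinal (P Q : Type -> Prop) (K : Type) :
  (forall L, infinite_set [set: L] -> P L <-> Q L) ->
  least_infinite_cardinal P K <-> least_infinite_cardinal Q K.
Proof.
move=> PQ; split=> -[Kinf PK Kleast]; split=> //; try exact/PQ.
  by move=> L Linf /(PQ _ Linf); exact: Kleast.
by move=> L Linf /(PQ _ Linf); exact: Kleast.
Qed.

(** * Open covers and closed discrete sets *)

Definition lindelof_le (X : topologicalType) (L : Type) : Prop :=
  forall C : set (set X), open_cover C ->
  exists C' : set (set X), [/\ C' `<=` C, open_cover C' & C' #<= [set: L]].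

(** The complement of [D] together with all the open sets that meet [D] in a
    single point form an open cover.  A subcover contains, for each point of
    [D], a set isolating this point, and these sets are distinct. *)
Lemma closed_discrete_card_le (X : topologicalType) (L : Type) (D : set X) :
  lindelof_le X L -> closed_discrete D -> D #<= [set: L].
Proof.
move=> XL [Dclosed Ddisc].
pose isol x := [set U : set X | open U /\ U `&` D = [set x]].
have isol_ex x : D x -> isol x !=set0.
  move=> Dx; have [V oV VE] := Ddisc [set SigSub (mem_set Dx)].
  exists V; split=> //; apply/seteqP; split=> [y [Vy Dy]|y ->].
    have : (set_val @^-1` V) (SigSub (mem_set Dy) : D) by [].
    by rewrite VE => /(congr1 val).
  split=> //; have : [set SigSub (mem_set Dx) : D] (SigSub (mem_set Dx)) by [].
  by rewrite -VE.
pose C := [set U : set X | U = ~` D \/ exists2 x, D x & isol x U].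
have /XL[C' [C'C [_ C'cov] C'L]] : open_cover C.
  split=> [U [->|[x _ []//]]|]; first exact: closed_openC.
  apply/seteqP; split=> // x _; have [Dx|nDx] := pselect (D x); last first.
    by exists (~` D) => //; left.
  have [U Ux] := isol_ex x Dx; exists U; first by right; exists x.
  by case: Ux => _ /seteqP[_ /(_ x erefl)[]].
apply: card_le_trans C'L; apply/card_le_relP; exists isol; split=> [x Dx|].
  have [U C'U Ux] : (\bigcup_(U in C') U) x by rewrite C'cov.
  exists U => //; have [UD|[y Dy Uy]] := C'C _ C'U; first by rewrite UD in Ux.
  case: (Uy) => _ UDy; suff -> : x = y by [].
  by have : (U `&` D) x by []; rewrite UDy.
move=> x x' U _ _ [_ Ux] [_ Ux'].
by have : [set x] x by []; rewrite -Ux Ux'.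
Qed.

(** In a T1 space the at most one point of [D] near a point outside [D] can be
    removed from the neighbourhood. *)
Lemma closed_discrete_locally_subsingleton (X : topologicalType) (D : set X) :
  accessible_space X ->
  (forall x, exists V, [/\ open V, V x &
     forall y z, V y -> V z -> D y -> D z -> y = z]) ->
  closed_discrete D.
Proof.
move=> XT1 loc; split.
  rewrite -[D]setCK; apply: open_closedC; rewrite openE => x nDx.
  have [V [oV Vx VD]] := loc x.
  have [[d [Vd Dd]]|VD0] := pselect (V `&` D !=set0); last first.
    apply: (filterS _ (open_nbhs_nbhs (conj oV Vx))) => y Vy Dy.
    by apply: VD0; exists y.
  have oW : open (V `&` ~` [set d]).
    by apply: openI => //; apply: closed_openC; exact: accessible_closed_set1.
  apply: (filterS _ (open_nbhs_nbhs (conj oW _))) => [y [Vy yd] Dy|].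
    exact/yd/VD.
  by split=> // xd; apply: nDx; rewrite xd.
move=> A; have /choice[V VP] := loc.
exists (\bigcup_(a in A) V (val a)).
  by apply: bigcup_open => a _; have [] := VP (val a).
apply/seteqP; split=> [a [b Ab Vba]|a Aa].
  have [_ Vb VD] := VP (val b).
  suff -> : a = b by [].
  by apply: val_inj; apply: VD => //; exact: set_valP.
by exists a => //; have [] := VP (val a).
Qed.

(** As [bool] is discrete, the sets of functions that agree with [f] on a finite
    set generate the neighbourhoods of [f].  It suffices that the filter [G]
    which they generate converges to [f], which can be tested coordinatewise. *)
Lemma nbhs_ptws_bool (T : choiceType) (f : {ptws T -> bool}) (U : set {ptws T -> bool}) :
  nbhs f U -> exists s : seq T,
    forall g : {ptws T -> bool}, (forall t, t \in s -> g t = f t) -> U g.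
Proof.
pose G : set_system {ptws T -> bool} :=
  filter_from [set: seq T] (fun s =>
    [set g : {ptws T -> bool} | forall t, t \in s -> g t = f t]).
have FG : Filter G.
  apply: filter_from_filter; first by exists [::].
  move=> s s' _ _; exists (s ++ s') => // g gf.
  by split=> t ts; apply: gf; rewrite mem_cat ts ?orbT.
have Gf : G --> f.
  apply/cvg_sup => t V; rewrite nbhsE => -[W [[B oB BW] Wf] WV].
  exists [:: t] => // g gf; apply: WV; rewrite -BW /=.
  by rewrite -BW in Wf; rewrite /proj gf ?mem_head.
by move=> /Gf[s _ sU]; exists s.
Qed.

(** * The ray space of a tree *)

Section RaySpace.
Variables (d : Order.disp_t) (T : porderType d).
Local Open Scope order_scope.
Local Open Scope classical_set_scope.
Import Order.TTheory.
Implicit Types (s t : T) (R : ray_space T).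

Definition cone t : set (ray_space T) := [set R : ray_space T | val R t].

Lemma ray_spaceP R : ray [set t | val R t].
Proof. exact: set_valP R. Qed.

Lemma ray_le R s t : val R t -> s <= t -> val R s.
Proof. by have [_ + _ _] := ray_spaceP R; apply. Qed.

Lemma ray_total R s t : val R s -> val R t -> s <= t \/ t <= s.
Proof. by have [_ _ + _] := ray_spaceP R; apply. Qed.

Lemma ray_gt R t : val R t -> exists2 s, val R s & t < s.
Proof. by have [_ _ _] := ray_spaceP R; apply. Qed.

Lemma ray_of (A : set T) : ray A -> exists R, forall t, val R t <-> A t.
Proof.
move=> rA; pose f : {ptws T -> bool} := fun t => `[< A t >].
have rf : [set g : {ptws T -> bool} | ray [set t | g t]] f.
  by rewrite /= (_ : mkset _ = A)//; apply/seteqP; split=> x /asboolP.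
by exists (exist _ f (mem_set rf)) => t; split=> /asboolP.
Qed.

Lemma pruned_ray_space : pruned T -> exists f : T -> ray_space T, forall t, cone t (f t).
Proof.
move=> prunedT; suff /choice[f fP] : forall t, exists R, cone t R by exists f.
by move=> t; have [A /ray_of[R RA] At] := prunedT t; exists R; apply/RA.
Qed.

Lemma open_coord t b : open [set R : ray_space T | val R t = b].
Proof.
exists [set g : {ptws T -> bool} | g t = b] => //.
have /continuousP ct : continuous (proj t : {ptws T -> bool} -> bool).
  exact: (@proj_continuous T (fun=> bool) t).
by apply: (ct [set b]); exact: discrete_open.
Qed.

Lemma open_cone t : open (cone t). Proof. exact: open_coord. Qed.

Lemma open_setC_cone t : open (~` cone t).
Proof.
rewrite (_ : ~` _ = [set R : ray_space T | val R t = false]); first exact: open_coord.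
by apply/seteqP; split=> R => [/negP/negbTE|/negbT/negP].
Qed.

Lemma ray_space_accessible : accessible_space (ray_space T).
Proof.
move=> R S /eqP RS.
have /existsNP[t Rt] : ~ forall t, val R t = val S t.
  by move=> RSt; apply/RS/val_inj/funext.
exists [set Q : ray_space T | val Q t = val R t]; split; first exact: open_coord.
  by rewrite inE.
by rewrite inE => /= St; apply: Rt.
Qed.

(** A basic neighbourhood of [R] prescribes finitely many members and finitely
    many non-members.  The members amount to the single condition [cone s] for
    the largest of them.  A non-member [u] that is not above all of [R] is not
    above some [r] in [R]; then [cone r] and [cone u] are disjoint, so that
    enlarging [s] to [r] makes the condition on [u] superfluous.  Only
    non-members above the whole of [R] remain. *)
Lemma ray_nbhs R (U : set (ray_space T)) : open U -> U R ->
  exists s, exists ts : seq T, [/\ val R s,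
    forall t, t \in ts -> ~ val R t /\ forall r, val R r -> r <= t &
    forall Q, cone s Q -> (forall t, t \in ts -> ~ cone t Q) -> U Q].
Proof.
move=> [V oV <-] VR.
have [l lV] := nbhs_ptws_bool (open_nbhs_nbhs (conj oV VR)).
suff [s [ts [Rs tsP Ql]]] : exists s, exists ts : seq T, [/\ val R s,
    forall t, t \in ts -> ~ val R t /\ forall r, val R r -> r <= t &
    forall Q, cone s Q -> (forall t, t \in ts -> ~ cone t Q) ->
      forall t, t \in l -> val Q t = val R t].
  by exists s, ts; split=> // Q Qs Qts; apply: lV; exact: Ql.
elim: l {lV} => [|u l [s [ts [Rs tsP Ql]]]].
  by have [[s Rs] _ _ _] := ray_spaceP R; exists s, [::].
have extend s' : val R s' -> (forall Q, cone s' Q -> val Q u = val R u) ->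
    exists s0, exists ts : seq T, [/\ val R s0,
    forall t, t \in ts -> ~ val R t /\ forall r, val R r -> r <= t &
    forall Q, cone s0 Q -> (forall t, t \in ts -> ~ cone t Q) ->
      forall t, t \in u :: l -> val Q t = val R t].
  move=> Rs' s'u; have [ss'|s's] := ray_total Rs Rs'.
    exists s', ts; split=> // Q Qs' Qts t; rewrite inE => /predU1P[->|tl].
      exact: s'u.
    by apply: Ql => //; exact: ray_le ss'.
  exists s, ts; split=> // Q Qs Qts t; rewrite inE => /predU1P[->|tl].
    by apply: s'u; exact: ray_le s's.
  exact: Ql.
have [Ru|/negP nRu] := boolP (val R u).
  by apply: (extend u) => // Q Qu; rewrite Ru.
have [ub|/existsNP[r /not_implyP[Rr ru]]] := pselect (forall r, val R r -> r <= u).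
  exists s, (u :: ts); split=> // [t|Q Qs Qts t].
    by rewrite inE => /predU1P[->|/tsP].
  rewrite inE => /predU1P[->|tl].
    by rewrite (negbTE (introN idP nRu)); apply/negP/Qts/mem_head.
  by apply: Ql => // v vts; apply: Qts; rewrite inE vts orbT.
apply: (extend r) => // Q Qr; rewrite (negbTE (introN idP nRu)); apply/negP => Qu.
have [//|ur] := ray_total Qr Qu.
by apply: nRu; exact: ray_le ur.
Qed.

Hypothesis treeT : tree T.

Lemma tree_le_total s t u : s <= u -> t <= u -> s <= t \/ t <= s.
Proof.
rewrite !le_eqVlt => /predU1P[->|su] /predU1P[->|tu]; rewrite ?eqxx ?su ?tu ?orbT; auto.
have /orP[] := wochoice.wo_chainW (@treeT u) su tu; rewrite le_eqVlt; auto.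
Qed.

(** The least element of [R] above [t] is an immediate successor of [t] in the
    tree because [R] is closed downwards.  Well-foundedness is available only
    below a node, here a node [t2] of [R] with an element of [R] between [t]
    and [t2]. *)
Lemma ray_immediate_successor R t : val R t ->
  exists2 s, immediate_successors t s & val R s.
Proof.
move=> Rt; have [t1 Rt1 tt1] := ray_gt Rt; have [t2 Rt2 t12] := ray_gt Rt1.
have [||s [[/andP[ts st2] smin] _]] := @treeT t2 [pred s | (t < s) && (s < t2)].
- by move=> s /andP[].
- by exists t1; rewrite inE tt1.
exists s; last exact: ray_le (ltW st2).
split=> // -[u /andP[tu us]].
have su : s <= u by apply: smin; rewrite inE tu (lt_trans us).
by have := lt_geF us; rewrite su.
Qed.

Lemma immediate_successors_le t s s' :
  immediate_successors t s -> immediate_successors t s' -> s <= s' -> s = s'.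
Proof.
move=> [ts _] [_ s'P]; rewrite le_eqVlt => /predU1P[//|ss'].
by exfalso; apply: s'P; exists s; rewrite ts.
Qed.

Lemma ray_immediate_successor_inj R t s s' :
  immediate_successors t s -> immediate_successors t s' ->
  val R s -> val R s' -> s = s'.
Proof.
move=> ts ts' Rs Rs'; have [ss'|s's] := ray_total Rs Rs'.
  exact: immediate_successors_le ts ts' ss'.
by apply: esym; exact: immediate_successors_le ts' ts s's.
Qed.

(** For a choice [f s] of rays through the successors [s] of [t], the clopen
    sets [cone s] and the complement of [cone t] cover the space, and each of
    them contains at most one of the rays [f s]. *)
Lemma closed_discrete_successors t : pruned T ->
  exists2 D : set (ray_space T), closed_discrete D & D #= immediate_successors t.
Proof.
move=> /pruned_ray_space[f fP].
exists (f @` immediate_successors t); last first.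
  apply: inj_card_eq => s s' /set_mem ts /set_mem ts' ff.
  apply: (@ray_immediate_successor_inj (f s) t) => //; first exact: fP.
  by rewrite ff; exact: fP.
apply: closed_discrete_locally_subsingleton; first exact: ray_space_accessible.
move=> R; have [Rt|nRt] := pselect (cone t R).
  have [s ts Rs] := ray_immediate_successor Rt.
  have fs u : immediate_successors t u -> cone s (f u) -> f u = f s.
    move=> tu fus; congr f.
    by apply: (@ray_immediate_successor_inj (f u) t) => //; exact: fP.
  exists (cone s); split=> //; first exact: open_cone.
  by move=> P Q + + [u tu uP] [v tv vQ]; rewrite -uP -vQ => /fs -> // /fs ->.
exists (~` cone t); split=> //; first exact: open_setC_cone.
move=> P Q nPt _ [u [tu _] uP]; exfalso; apply: nPt; rewrite -uP.
exact: ray_le (fP u) (ltW tu).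
Qed.

Variable L : Type.
Hypothesis Linf : infinite_set [set: L].

(** The ideal of the sets covered by at most [L] members of [C]; it is closed
    under unions of [L] sets. *)
Definition covered_le (C : set (set (ray_space T))) (A : set (ray_space T)) :=
  exists C', [/\ C' `<=` C, A `<=` \bigcup_(U in C') U & C' #<= [set: L]].

Lemma finite_card_le (I : Type) (A : set I) : finite_set A -> A #<= [set: L].
Proof.
move=> /finite_set_countable Ac; apply: card_le_trans Ac _; exact/infiniteP.
Qed.

Lemma covered_le_bigcup C (I : Type) (D : set I) (F : I -> set (ray_space T)) :
  D #<= [set: L] -> (forall i, D i -> covered_le C (F i)) ->
  covered_le C (\bigcup_(i in D) F i).
Proof.
move=> DL DF; have /choice[E EP] : forall i, exists C', D i ->
    [/\ C' `<=` C, F i `<=` \bigcup_(U in C') U & C' #<= [set: L]].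
  move=> i; have [Di|nDi] := pselect (D i); last by exists set0.
  by have [C'] := DF _ Di; exists C'.
exists (\bigcup_(i in D) E i); split.
- by apply: bigcup_sub => i /EP[].
- move=> R [i Di FiR]; have [_ /(_ _ FiR)[U EU UR] _] := EP _ Di.
  by exists U => //; exists i.
- by apply: card_le_bigcup => // i /EP[].
Qed.

Lemma covered_le_subset C (A B : set (ray_space T)) :
  A `<=` B -> covered_le C B -> covered_le C A.
Proof. by move=> AB [C' [C'C BC' C'L]]; exists C'; split=> // R /AB/BC'. Qed.

Lemma covered_le1 (C : set (set (ray_space T))) U : C U -> covered_le C U.
Proof.
move=> CU; exists [set U]; split=> [_ ->//|R UR|]; first by exists U.
exact: finite_card_le.
Qed.

Lemma covered_leU C (A B : set (ray_space T)) :
  covered_le C A -> covered_le C B -> covered_le C (A `|` B).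
Proof.
move=> CA CB; rewrite -bigcup2inE.
by apply: covered_le_bigcup => [|[|[|]]//]; exact: finite_card_le.
Qed.

Lemma covered_le_cone_successors C t :
  immediate_successors t #<= [set: L] ->
  (forall s, immediate_successors t s -> covered_le C (cone s)) ->
  covered_le C (cone t).
Proof.
move=> tL ts.
apply: covered_le_subset (covered_le_bigcup tL ts).
move=> R /ray_immediate_successor[s st Rs].
by exists s.
Qed.

(** A single member of [C] containing [R] covers all of some [cone s] with [s] in
    [R], up to finitely many cones above [R]. *)
Lemma ray_covered_cone C R : open_cover C ->
  (forall t, ~ val R t -> (forall r, val R r -> r <= t) -> covered_le C (cone t)) ->
  exists2 s, val R s & covered_le C (cone s).
Proof.
move=> [Copen Ccov] above.
have [U CU UR] : (\bigcup_(U in C) U) R by rewrite Ccov.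
have [s [ts [Rs tsP UQ]]] := ray_nbhs (Copen _ CU) UR.
exists s => //.
apply: (@covered_le_subset _ _ (U `|` \bigcup_(t in [set` ts]) cone t)).
  move=> Q Qs; have [QU|nQU] := pselect (U Q); first by left.
  right; apply: contrapT => Qts; apply/nQU/UQ => // t tts Qt.
  by apply: Qts; exists t.
apply: covered_leU; first exact: covered_le1.
apply: covered_le_bigcup; first exact/finite_card_le/finite_seq.
by move=> t /tsP[]; exact: above.
Qed.

(** A maximal chain [B] of bad nodes contains every bad node comparable with all
    of [B].  So it contains the root, and it is closed downwards because the
    nodes below a bad node are bad.  It has no last element by
    [covered_le_cone_successors], and hence is a ray, which [ray_covered_cone]
    contradicts. *)
Lemma lindelof_le_ray_space : rooted T ->
  (forall t, immediate_successors t #<= [set: L]) -> lindelof_le (ray_space T) L.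
Proof.
move=> [r rmin] TL C Ccov.
have coneS s t : s <= t -> cone t `<=` cone s by move=> st R Rt; exact: ray_le st.
have [Cr|nCr] := pselect (covered_le C (cone r)).
  have [C' [C'C rC' C'L]] := Cr; exists C'; split=> //; split.
    by move=> U /C'C; have [+ _] := Ccov; apply.
  apply/seteqP; split=> // R _; apply: rC'.
  by have [[s Rs] _ _ _] := ray_spaceP R; exact: ray_le (rmin s).
exfalso.
pose bad t := ~ covered_le C (cone t).
have bad_le s t : s <= t -> bad t -> bad s.
  by move=> st; apply/contra_not/covered_le_subset; exact: coneS.
pose P (B : set T) := B `<=` bad /\ total_on B <=%O.
have [|B [[Bbad Btot] Bmax]] := @Zorn_bigcup _ P.
  move=> F FP Ftot; split; first by apply: bigcup_sub => B /FP[].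
  move=> s t [A FA As] [B FB Bt].
  have [/(_ _ As) Bs|/(_ _ Bt) At] := Ftot _ _ FA FB.
    by have [_] := FP _ FB; apply.
  by have [_] := FP _ FA; apply.
have Bmem t : bad t -> (forall s, B s -> s <= t \/ t <= s) -> B t.
  move=> tbad tB; apply: contrapT => nBt; apply: (Bmax (t |` B)).
    by split; [exact: subsetUr|move=> /(_ t (or_introl erefl))].
  split=> [s [->//|/Bbad//]|s u [->|Bs] [->|Bu]]; first by left.
  - by have [|] := tB _ Bu; auto.
  - exact: tB.
  - exact: Btot.
have Br : B r by apply: Bmem => // s Bs; right.
have Ble s t : B t -> s <= t -> B s.
  move=> Bt st; apply: Bmem; first exact/(bad_le _ _ st)/Bbad.
  move=> u Bu; have [ut|tu] := Btot _ _ Bu Bt; last by right; exact: le_trans tu.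
  exact: tree_le_total ut st.
have Bgt t : B t -> exists2 s, B s & t < s.
  move=> Bt; apply: contrapT => nB.
  have Bub s : B s -> s <= t.
    move=> Bs; have [//|] := Btot _ _ Bs Bt; rewrite le_eqVlt => /predU1P[->//|ts].
    by exfalso; apply: nB; exists s.
  apply: (Bbad _ Bt); apply: covered_le_cone_successors => // s [ts sP].
  apply: contrapT => sbad; apply: nB; exists s => //.
  by apply: Bmem => // u /Bub ut; left; exact/ltW/(le_lt_trans ut).
have [R RE] : exists R, forall t, val R t <-> B t by apply: ray_of; split=> //; exists r.
have [s /RE/Bbad//] : exists2 s, val R s & covered_le C (cone s).
apply: ray_covered_cone => // t nRt tub; apply: contrapT => tbad.
by apply/nRt/RE/Bmem => // u /RE Ru; left; exact: tub.
Qed.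

End RaySpace.

Theorem proposition2p12 (d : Order.disp_t) (T : porderType d)
    (treeT : tree T) (rootedT : rooted T) (prunedT : pruned T)
    (K : Type) (infK : infinite_set [set: K]) :
  (lindelof_degree (ray_space T) K <-> extent (ray_space T) K) /\
  (extent (ray_space T) K <->
   least_infinite_cardinal (fun L : Type =>
     forall t : T, immediate_successors t #<= [set: L]) K).
Proof.
pose extent_le L := forall D : set (ray_space T), closed_discrete D -> D #<= [set: L].
pose succ_le L := forall t : T, immediate_successors t #<= [set: L].
have lindelof_extent L : lindelof_le (ray_space T) L -> extent_le L.
  by move=> XL D; exact: closed_discrete_card_le.
have extent_succ L : extent_le L -> succ_le L.
  move=> XL t; have [D /XL DL Dt] := closed_discrete_successors treeT t prunedT.
  by rewrite -(card_le_eql Dt).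
have succ_lindelof L : infinite_set [set: L] -> succ_le L -> lindelof_le (ray_space T) L.
  by move=> Linf; exact: lindelof_le_ray_space.
have extentE : extent (ray_space T) K <-> least_infinite_cardinal extent_le K.
  exact: least_infinite_cardinal_sup.
split; rewrite extentE; apply: eq_least_infinite_cardinal => L Linf.
  by split=> [/lindelof_extent//|/extent_succ]; exact: succ_lindelof.
by split=> [/extent_succ//|/(succ_lindelof _ Linf)]; exact: lindelof_extent.
Qed.
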